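(* Let $M$ be a smooth oriented manifold of dimension $n$. Suppose $\nabla_a$ is a special torsion-free connection on $TM$ and there is a (Riemannian, i.e. positive definite) metric tensor $\sigma^{ab}$ on $M$, written contravariantly, such that $$\nabla_a\sigma^{bc}=\delta_a{}^b\mu^c+\delta_a{}^c\mu^b\quad\text{for some vector field }\mu^a.$$ Then $\nabla_a$ is projectively equivalent to a metric connection, i.e. to the Levi-Civita connection of some Riemannian metric on $M$.
   Context: Abstract index notation is used: indices mark tensor type, repeated indices denote the natural pairing, and $\delta_a{}^b$ is the identity endomorphism. All objects are smooth. Two torsion-free connections $\nabla$ and $\hat\nabla$ on $TM$ are projectively equivalent if they have the same geodesics as unparameterised curves; equivalently, there is a $1$-form $\Upsilon_a$ such that $\hat\nabla_aX^b=\nabla_aX^b+\Upsilon_aX^b+\delta_a{}^b\Upsilon_cX^c$ for all vector fields $X^b$. A torsion-free connection $\nabla$ is called special if there is a (nowhere vanishing) volume form $\epsilon_{bc\cdots d}$ on $M$ with $\nabla_a\epsilon_{bc\cdots d}=0$. *)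

(* Defs.v *)
From HB Require Import structures.
From mathcomp Require Import all_boot all_order all_algebra all_fingroup.
From mathcomp Require Import all_classical all_reals all_analysis.

Set Implicit Arguments.
Unset Strict Implicit.
Unset Printing Implicit Defensive.

Import Order.TTheory GRing.Theory Num.Theory.
Import numFieldNormedType.Exports.

Local Open Scope classical_set_scope.
Local Open Scope ring_scope.

Section Calculus.
Variables (R : realType) (n : nat).
Implicit Types (f : 'rV[R]_n -> R) (U : set 'rV[R]_n).

Definition partial (i : 'I_n) f : 'rV[R]_n -> R :=
  fun x => 'D_(delta_mx 0 i) f x.

(* [Ck k U f], for U open: f is of class C^k on U. *)
Fixpoint Ck (k : nat) U f : Prop :=
  if k is k'.+1 then
    (forall x, U x -> differentiable f x) /\ (forall i, Ck k' U (partial i f))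
  else forall x, U x -> {for x, continuous f}.

Definition smooth_on U f : Prop := forall k, Ck k U f.

End Calculus.

Section Charts.
Variables (R : realType) (n : nat) (M : topologicalType).

(* [cmap] and [cinv] are total functions; their values outside [cdom] and
   [cmap @` cdom] are irrelevant. *)
Record chart := Chart {
  cdom : set M ;
  cmap : M -> 'rV[R]_n ;
  cinv : 'rV[R]_n -> M ;
  cdom_open : open cdom ;
  cimg_open : open (cmap @` cdom) ;
  cmapK : forall u, cdom u -> cinv (cmap u) = u ;
  cmap_continuous : forall u, cdom u -> {for u, continuous cmap} ;
  cinv_continuous : forall x, (cmap @` cdom) x -> {for x, continuous cinv}
}.

Definition cimg (c : chart) : set 'rV[R]_n := cmap c @` cdom c.

(* k-th component of the change of coordinates from c to c' *)
Definition transition (c c' : chart) (k : 'I_n) : 'rV[R]_n -> R :=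
  fun x => cmap c' (cinv c x) 0 k.

Definition compatible (c c' : chart) : Prop :=
  forall k,
    smooth_on (cmap c @` (cdom c `&` cdom c')) (transition c c' k) /\
    smooth_on (cmap c' @` (cdom c `&` cdom c')) (transition c' c k).

(* entry (k, i) is d y^k / d x^i, for x, y the coordinates of c, c' *)
Definition jacobian (c c' : chart) (x : 'rV[R]_n) : 'M[R]_n :=
  \matrix_(k, i) partial i (transition c c' k) x.

End Charts.

Record manifold (R : realType) (n : nat) := Manifold {
  carrier :> topologicalType ;
  manifold_hausdorff : hausdorff_space carrier ;
  manifold_second_countable : @second_countable carrier ;
  atlas : set (chart R n carrier) ;
  atlas_cover : forall u : carrier, exists2 c, atlas c & cdom c u ;
  atlas_compatible : forall c c', atlas c -> atlas c' -> compatible c c' ;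
  atlas_maximal : forall c,
    (forall c', atlas c' -> compatible c c') -> atlas c
}.

Arguments atlas {R n} m.

Record orientation (R : realType) (n : nat) (M : manifold R n) := Orientation {
  oatlas : set (chart R n M) ;
  oatlas_sub : oatlas `<=` atlas M ;
  oatlas_cover : forall u : M, exists2 c, oatlas c & cdom c u ;
  oatlas_positive : forall c c', oatlas c -> oatlas c' ->
    forall u, cdom c u -> cdom c' u -> 0 < \det (jacobian c c' (cmap c u))
}.

Section Tensors.
Variables (R : realType) (n : nat) (M : manifold R n).
Local Notation chart := (chart R n M).

(* A smooth tensor field with p contravariant and q covariant indices, given by
   its components in every chart of the (maximal) atlas: [tcomp c I J x] is
   T^I_J at the point whose coordinates in c are x.  Components in charts
   outside the atlas, or at x outside the image of c, carry no information. *)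
Record tensor (p q : nat) := Tensor {
  tcomp :> chart -> p.-tuple 'I_n -> q.-tuple 'I_n -> 'rV[R]_n -> R ;
  tensor_smooth : forall c, atlas M c ->
    forall I J, smooth_on (cimg c) (tcomp c I J) ;
  tensor_law : forall c c', atlas M c -> atlas M c' ->
    forall u, cdom c u -> cdom c' u ->
    let x := cmap c u in let y := cmap c' u in
    forall (I : p.-tuple 'I_n) (J : q.-tuple 'I_n),
    tcomp c' I J y =
      \sum_(A : p.-tuple 'I_n) \sum_(B : q.-tuple 'I_n)
        (\prod_(r < p) jacobian c c' x (tnth I r) (tnth A r)) *
        (\prod_(s < q) jacobian c' c y (tnth B s) (tnth J s)) *
        tcomp c A B x
}.

Definition vector_field := tensor 1 0.
Definition one_form := tensor 0 1.

(* A connection on TM, given by its Christoffel symbols: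
   [christoffel c k i j] is Gamma^k_(i j), with the convention
   nabla_i X^k = d_i X^k + Gamma^k_(i j) X^j. *)
Record connection := Connection {
  christoffel :> chart -> 'I_n -> 'I_n -> 'I_n -> 'rV[R]_n -> R ;
  christoffel_smooth : forall c, atlas M c ->
    forall k i j, smooth_on (cimg c) (christoffel c k i j) ;
  christoffel_law : forall c c', atlas M c -> atlas M c' ->
    forall u, cdom c u -> cdom c' u ->
    let x := cmap c u in let y := cmap c' u in
    forall k i j,
    christoffel c' k i j y =
      (\sum_(k1 < n) \sum_(i1 < n) \sum_(j1 < n)
         jacobian c c' x k k1 * jacobian c' c y i1 i * jacobian c' c y j1 j *
         christoffel c k1 i1 j1 x) +
      \sum_(m < n)
         jacobian c c' x k m * partial i (partial j (transition c' c m)) y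
}.

Definition torsion_free (D : connection) : Prop :=
  forall c, atlas M c -> forall x, cimg c x ->
  forall k i j, D c k i j x - D c k j i x = 0.

Definition tset (p : nat) (t : p.-tuple 'I_n) (r : 'I_p) (m : 'I_n) :
  p.-tuple 'I_n := [tuple if s == r then m else tnth t s | s < p].

(* components of the covariant derivative, nabla_a T^I_J *)
Definition nabla (D : connection) (p q : nat) (T : tensor p q)
    (c : chart) (a : 'I_n) (I : p.-tuple 'I_n) (J : q.-tuple 'I_n)
    (x : 'rV[R]_n) : R :=
  partial a (T c I J) x
  + \sum_(r < p) \sum_(m < n) D c (tnth I r) a m x * T c (tset I r m) J x
  - \sum_(s < q) \sum_(m < n) D c m a (tnth J s) x * T c I (tset J s m) x.

Definition parallel (D : connection) (p q : nat) (T : tensor p q) : Prop :=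
  forall c, atlas M c -> forall x, cimg c x ->
  forall a I J, nabla D T c a I J x = 0.

Definition alternating (q : nat) (T : tensor 0 q) : Prop :=
  forall c, atlas M c -> forall x, cimg c x ->
  forall (s : 'S_q) (J : q.-tuple 'I_n),
    T c [tuple] [tuple tnth J (s r) | r < q] x =
      (-1) ^+ s * T c [tuple] J x.

Definition nowhere_vanishing (p q : nat) (T : tensor p q) : Prop :=
  forall c, atlas M c -> forall x, cimg c x -> exists I J, T c I J x != 0.

Definition volume_form (e : tensor 0 n) : Prop :=
  alternating e /\ nowhere_vanishing e.

Definition special (D : connection) : Prop :=
  torsion_free D /\ exists e : tensor 0 n, volume_form e /\ parallel D e.

Definition riemannian_metric (g : tensor 0 2) : Prop :=
  forall c, atlas M c -> forall x, cimg c x ->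
  (forall a b, g c [tuple] [tuple a; b] x = g c [tuple] [tuple b; a] x) /\
  (forall v : 'rV[R]_n, v != 0 ->
    0 < \sum_(a < n) \sum_(b < n) g c [tuple] [tuple a; b] x * v 0 a * v 0 b).

Definition contravariant_riemannian_metric (h : tensor 2 0) : Prop :=
  forall c, atlas M c -> forall x, cimg c x ->
  (forall a b, h c [tuple a; b] [tuple] x = h c [tuple b; a] [tuple] x) /\
  (forall w : 'rV[R]_n, w != 0 ->
    0 < \sum_(a < n) \sum_(b < n) h c [tuple a; b] [tuple] x * w 0 a * w 0 b).

Definition levi_civita (g : tensor 0 2) (D : connection) : Prop :=
  torsion_free D /\ parallel D g.

Definition metric_connection (D : connection) : Prop :=
  exists g : tensor 0 2, riemannian_metric g /\ levi_civita g D.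

Definition projectively_equivalent (D D' : connection) : Prop :=
  exists Y : one_form, forall X : vector_field,
  forall c, atlas M c -> forall x, cimg c x -> forall a b : 'I_n,
    nabla D' X c a [tuple b] [tuple] x =
      nabla D X c a [tuple b] [tuple] x
      + Y c [tuple] [tuple a] x * X c [tuple b] [tuple] x
      + (a == b)%:R *
          \sum_(d < n) Y c [tuple] [tuple d] x * X c [tuple d] [tuple] x.

End Tensors.

(* Main.v *)
(* Write [f] for the component of a parallel volume form in a chart, [S] for the
   matrix of sigma, [s := f^2 det S] and [nu := S^-1 mu].  The function [s] is
   chart independent and, by Jacobi's formula, the equation on sigma gives
   [ds = 2 s nu].  With [Upsilon := - nu] the projectively changed connection
   annihilates [s sigma^{ab}], so it is the Levi-Civita connection of the metric
   [s^-1 sigma_{ab}].  Since [nu] is given algebraically, no logarithm of [s]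
   is needed. *)
Require Import Defs.
From mathcomp Require Import all_boot all_order all_algebra all_fingroup.
From mathcomp Require Import all_classical all_reals all_analysis.
From mathcomp Require Import ring lra.

Set Implicit Arguments.
Unset Strict Implicit.
Unset Printing Implicit Defensive.

Import Order.TTheory GRing.Theory Num.Theory.
Import numFieldNormedType.Exports.

Local Open Scope classical_set_scope.
Local Open Scope ring_scope.

(** * Calculus of smooth functions *)

(** The choice of [Upsilon] comes from how a projective change acts on $\sigma$: it adds
    $2\Upsilon_a\sigma^{bc}+\delta_a{}^b\Upsilon_d\sigma^{dc}+\delta_a{}^c\Upsilon_d\sigma^{bd}$ to
    $\nabla_a\sigma^{bc}$. Taking $\Upsilon_d=-\nu_d$ turns the last two terms into
    $-\delta_a{}^b\mu^c-\delta_a{}^c\mu^b$, which cancels the right-hand side of the equation. What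
    remains is $-2\nu_a\sigma^{bc}$, a pure rescaling, and the factor $s$ absorbs it because its
    logarithmic derivative is $2\nu$.

    Tensors and connections are families of chart components. Hence each new global object is a
    matrix formula in every chart, accompanied by a proof of smoothness and of its transformation
    law. Once a chart and a derivative index [a] are fixed, the covariant equations become matrix
    identities in which the Christoffel symbols form one matrix. The analytic input is then the
    differentiation of determinants and inverses of matrix-valued functions. *)

Section SmoothFunctions.
Variables (R : realType) (n : nat).
Implicit Types (f g : 'rV[R]_n -> R) (U : set 'rV[R]_n).

(** The difference [d] vanishes near [x], so its first-order expansion with zero linear part has no
    remainder there; [g] is then a sum of two differentiable functions. *)
Lemma differentiable_congr f g x : {near x, f =1 g} ->
  differentiable f x -> differentiable g x.
Proof.
move=> fg df; set d : 'rV[R]_n -> R := g - f.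
have d0 : {near x, d =1 cst 0}.
  by apply: filterS fg => y fgy; rewrite /d/= fctE/= opprfctE fgy subrr.
suff dd : differentiable d x.
  by rewrite -(subrK f g); exact: differentiableD.
have dE : d \o shift x = cst (d x) + (\0 : {linear 'rV[R]_n -> R}) +o_ 0 id.
  apply/eqaddoP => e e0.
  have := d0; rewrite (near_shift 0 x)/= subr0 => d0'.
  apply: filterS d0' => y.
  have dx0 : d x = 0 := nbhs_singleton d0.
  rewrite /= !fctE/= dx0 => ->.
  by rewrite addr0 subr0 normr0 mulr_ge0// ltW.
have c0 : continuous (\0 : {linear 'rV[R]_n -> R}) by exact: cst_continuous.
by apply/diff_locallyP; rewrite (diff_unique c0 dE).
Qed.

Lemma partial_congr U f g i x : open U -> (forall y, U y -> f y = g y) -> U x ->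
  partial i f x = partial i g x.
Proof.
move=> oU fg Ux; rewrite /partial; apply: near_eq_derive.
by near=> y; apply: fg; near: y; exact: open_nbhs_nbhs.
Unshelve. all: by end_near. Qed.

Lemma partialD f g i x : differentiable f x -> differentiable g x ->
  partial i (fun y => f y + g y) x = partial i f x + partial i g x.
Proof. by move=> df dg; apply: deriveD; apply: diff_derivable. Qed.

Lemma partialM f g i x : differentiable f x -> differentiable g x ->
  partial i (fun y => f y * g y) x = partial i f x * g x + f x * partial i g x.
Proof.
move=> df dg; rewrite /partial (@deriveM _ _ f g); try exact: diff_derivable.
by rewrite addrC /GRing.scale/= (mulrC (g x)).
Qed.

Lemma partialV f i x : f x != 0 -> differentiable f x ->
  partial i (fun y => (f y)^-1) x = - (f x)^-1 ^+ 2 * partial i f x.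
Proof.
move=> f0 df; rewrite /partial (@deriveV _ _ f)//; last exact: diff_derivable.
by rewrite /GRing.scale/= exprVn.
Qed.

Lemma partial_cst (k : R) i x :
  partial i (fun _ : 'rV[R]_n => k) x = 0.
Proof. exact: derive_cst. Qed.

Lemma partial_sum (I : Type) (r : seq I) (P : pred I) (F : I -> 'rV[R]_n -> R) i x :
  (forall j, P j -> differentiable (F j) x) ->
  partial i (fun y => \sum_(j <- r | P j) F j y) x =
  \sum_(j <- r | P j) partial i (F j) x
  /\ differentiable (fun y => \sum_(j <- r | P j) F j y) x.
Proof.
move=> dF; elim: r => [|j r [IH1 IH2]].
  rewrite big_nil.
  rewrite (_ : (fun y => _) = (fun _ => 0)); last first.
    by apply/funext => y; rewrite big_nil.
  by split; [exact: partial_cst|exact: differentiable_cst].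
rewrite big_cons; have [Pj|Pj] := boolP (P j).
  rewrite (_ : (fun y => _) = (fun y => F j y + \sum_(j <- r | P j) F j y)).
    rewrite partialD -?IH1//; last exact: dF.
    by split => //; apply: differentiableD => //; exact: dF.
  by apply/funext => y; rewrite big_cons Pj.
rewrite (_ : (fun y => _) = (fun y => \sum_(j <- r | P j) F j y))//.
by apply/funext => y; rewrite big_cons (negbTE Pj).
Qed.

Lemma smooth_differentiable U f x : smooth_on U f -> U x -> differentiable f x.
Proof. by move=> /(_ 1%N)[+ _]; exact. Qed.

Lemma smooth_partial U f i : smooth_on U f -> smooth_on U (partial i f).
Proof. by move=> sf k; have [_] := sf k.+1; exact. Qed.

(** The recursion in [Ck] passes through [partial i f] as a function on the whole space, while the
    rules for derivatives give equalities on [U] only. This lemma transports regularity along such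
    equalities; openness of [U] makes the partial derivatives agree on [U] again. *)
Lemma Ck_congr U k f g : open U -> (forall y, U y -> f y = g y) ->
  Ck k U f -> Ck k U g.
Proof.
move=> oU.
have nU h1 h2 x : (forall y, U y -> h1 y = h2 y) -> U x -> {near x, h1 =1 h2}.
  by move=> h12 Ux; near=> y; apply: h12; near: y; exact: open_nbhs_nbhs.
elim: k f g => [|k IH] f g fg /=.
  move=> cf x Ux; rewrite /prop_for/continuous_at -fg//.
  apply: cvg_trans (cf x Ux); apply: (@near_eq_cvg _ _ (nbhs x)).
  exact: (nU _ f g x fg Ux).
move=> [df pf]; split=> [x Ux|i].
  by apply: differentiable_congr (df x Ux); exact: nU Ux.
by apply: IH (pf i) => y Uy; exact: partial_congr Uy.
Unshelve. all: by end_near. Qed.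

Lemma smooth_continuous U f x : smooth_on U f -> U x -> {for x, continuous f}.
Proof. by move=> /(_ 0%N); exact. Qed.

Lemma smooth_on_cst U k : smooth_on U (fun _ => k).
Proof.
move=> m; elim: m k => [|m IH] k /=; first by move=> x _; exact: cst_continuous.
split=> [x _|i]; first exact: differentiable_cst.
rewrite (_ : partial i _ = fun _ => 0); first exact: IH.
by apply/funext => x; exact: partial_cst.
Qed.

Lemma CkD U k f g : open U -> Ck k U f -> Ck k U g -> Ck k U (fun x => f x + g x).
Proof.
move=> oU; elim: k f g => [|k IH] f g /=.
  by move=> cf cg x Ux; apply: continuousD; [exact: cf|exact: cg].
move=> [df pf] [dg pg]; split=> [x Ux|i].
  by apply: differentiableD; [exact: df|exact: dg].
apply: (@Ck_congr U k (fun x => partial i f x + partial i g x)) => //.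
  by move=> x Ux; rewrite partialD//; [exact: df|exact: dg].
exact: IH.
Qed.

Lemma smooth_onD U f g : open U -> smooth_on U f -> smooth_on U g ->
  smooth_on U (fun x => f x + g x).
Proof. by move=> oU sf sg k; exact: CkD. Qed.

(** Needed for the product rule, whose undifferentiated factors must be lowered by one class. *)
Lemma CkW U k f : Ck k.+1 U f -> Ck k U f.
Proof.
elim: k f => [|k IH] f [df pf].
  by move=> x Ux; exact/differentiable_continuous/df.
by split=> // i; exact: IH.
Qed.

Lemma CkM U k f g : open U -> Ck k U f -> Ck k U g -> Ck k U (fun x => f x * g x).
Proof.
move=> oU; elim: k f g => [|k IH] f g Cf Cg.
  by move=> x Ux; apply: continuousM; [exact: Cf|exact: Cg].
have [[df pf] [dg pg]] := (Cf, Cg); split=> [x Ux|i].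
  by apply: differentiableM; [exact: df|exact: dg].
apply: (@Ck_congr U k (fun x => partial i f x * g x + f x * partial i g x)) => //.
  by move=> x Ux; rewrite partialM//; [exact: df|exact: dg].
apply: CkD => //; apply: IH; [exact: pf|exact: CkW|exact: CkW|exact: pg].
Qed.

Lemma smooth_onM U f g : open U -> smooth_on U f -> smooth_on U g ->
  smooth_on U (fun x => f x * g x).
Proof. by move=> oU sf sg k; exact: CkM. Qed.

Lemma smooth_onN U f : open U -> smooth_on U f -> smooth_on U (fun x => - f x).
Proof.
move=> oU sf m.
rewrite (_ : (fun x => _) = (fun x => (-1) * f x)).
  by apply: smooth_onM => //; exact: smooth_on_cst.
by apply/funext => x; rewrite mulN1r.
Qed.

(** The derivative of the inverse is a polynomial in that inverse and a derivative of [f], so the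
    class of the inverse can be raised one step at a time. *)
Lemma smooth_onV U f : open U -> (forall x, U x -> f x != 0) ->
  smooth_on U f -> smooth_on U (fun x => (f x)^-1).
Proof.
move=> oU f0 sf; elim=> [|k IH] /=.
  by move=> x Ux; apply: continuousV; [exact: f0|exact: smooth_continuous Ux].
split=> [x Ux|i].
  by apply: differentiableV; [exact: smooth_differentiable Ux|exact: f0].
apply: (@Ck_congr U k (fun x => -1 * ((f x)^-1 * (f x)^-1 * partial i f x))) => //.
  move=> x Ux; rewrite partialV ?f0//; last exact: smooth_differentiable Ux.
  by rewrite expr2 mulN1r mulNr.
by do ![apply: CkM => //]; [exact: smooth_on_cst|exact: smooth_partial].
Qed.

Lemma smooth_on_sum U (I : Type) (r : seq I) (P : pred I)
    (F : I -> 'rV[R]_n -> R) : open U ->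
  (forall j, P j -> smooth_on U (F j)) ->
  smooth_on U (fun x => \sum_(j <- r | P j) F j x).
Proof.
move=> oU sF; elim: r => [|j r IH].
  rewrite (_ : (fun x => _) = fun _ => 0); first exact: smooth_on_cst.
  by apply/funext => x; rewrite big_nil.
rewrite (_ : (fun x => _) =
  fun x => (if P j then F j x else 0) + \sum_(j <- r | P j) F j x).
  apply: smooth_onD => //; have [Pj|Pj] := boolP (P j); first exact: sF.
  exact: smooth_on_cst.
by apply/funext => x; rewrite big_cons; case: ifP => //; rewrite add0r.
Qed.

Lemma smooth_on_prod U (I : Type) (r : seq I) (P : pred I)
    (F : I -> 'rV[R]_n -> R) : open U ->
  (forall j, P j -> smooth_on U (F j)) ->
  smooth_on U (fun x => \prod_(j <- r | P j) F j x).
Proof.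
move=> oU sF; elim: r => [|j r IH].
  rewrite (_ : (fun x => _) = fun _ => 1); first exact: smooth_on_cst.
  by apply/funext => x; rewrite big_nil.
rewrite (_ : (fun x => _) =
  fun x => (if P j then F j x else 1) * \prod_(j <- r | P j) F j x).
  apply: smooth_onM => //; have [Pj|Pj] := boolP (P j); first exact: sF.
  exact: smooth_on_cst.
by apply/funext => x; rewrite big_cons; case: ifP => //; rewrite mul1r.
Qed.

Lemma smooth_on_det m U (A : 'rV[R]_n -> 'M[R]_m) : open U ->
  (forall i j, smooth_on U (fun x => A x i j)) -> smooth_on U (fun x => \det (A x)).
Proof.
move=> oU sA; apply: smooth_on_sum => // s _.
apply: smooth_onM => //; first exact: smooth_on_cst.
exact: smooth_on_prod.
Qed.

(** Each summand is kept as a full product with one factor replaced, the shape in which it is a term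
    of a determinant with one differentiated row. The enumeration has no repetition, so the test
    [k == j] replaces exactly one factor. *)
Lemma partial_prod (I : finType) (F : I -> 'rV[R]_n -> R) i x :
  (forall j, differentiable (F j) x) ->
  partial i (fun y => \prod_j F j y) x =
    \sum_j \prod_k (if k == j then partial i (F k) x else F k x)
  /\ differentiable (fun y => \prod_j F j y) x.
Proof.
move=> dF; elim: (index_enum I) (index_enum_uniq I) => [_|a r IH /= /andP[ar ur]].
  rewrite big_nil.
  rewrite (_ : (fun y => _) = (fun _ => 1)); last first.
    by apply/funext => y; rewrite big_nil.
  by split; [exact: partial_cst|exact: differentiable_cst].
have [IH1 IH2] := IH ur.
rewrite (_ : (fun y => _) = (fun y => F a y * \prod_(j <- r) F j y)); last first.
  by apply/funext => y; rewrite big_cons.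
split; last exact: differentiableM.
rewrite partialM// IH1 !big_cons eqxx; congr (_ * _ + _).
  by apply: eq_big_seq => k kr; case: eqP ar => // <-; rewrite kr.
rewrite big_distrr/=; apply: eq_big_seq => j jr; rewrite big_cons.
by case: eqP ar => // ->; rewrite jr.
Qed.

Definition partial_mx p q (i : 'I_n) (A : 'rV[R]_n -> 'M[R]_(p, q)) x :=
  \matrix_(a, b) partial i (fun y => A y a b) x.

Lemma partial_mxM p q r i (A : 'rV[R]_n -> 'M[R]_(p, q))
    (B : 'rV[R]_n -> 'M[R]_(q, r)) x :
  (forall a b, differentiable (fun y => A y a b) x) ->
  (forall a b, differentiable (fun y => B y a b) x) ->
  partial_mx i (fun y => A y *m B y) x =
  partial_mx i A x *m B x + A x *m partial_mx i B x.
Proof.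
move=> dA dB; apply/matrixP => a b; rewrite !mxE.
rewrite (_ : (fun y => _) = (fun y => \sum_j A y a j * B y j b)); last first.
  by apply/funext => y; rewrite mxE.
rewrite (partial_sum _ _ _).1; last by move=> j _; exact: differentiableM.
rewrite -big_split/=; apply: eq_bigr => j _.
by rewrite partialM// !mxE.
Qed.

(** Jacobi's formula. The product rule gives a sum over [k] of determinants with row [k]
    differentiated; expanding each along that row leaves the cofactors of [A x], since a cofactor of
    row [k] does not see row [k]. *)
Lemma partial_det m i (A : 'rV[R]_n -> 'M[R]_m) x :
  (forall a b, differentiable (fun y => A y a b) x) ->
  partial i (fun y => \det (A y)) x = \tr (partial_mx i A x *m \adj (A x)).
Proof.
move=> dA.
pose A' k : 'M[R]_m :=
  \matrix_(a, b) (if a == k then partial i (fun y => A y a b) x else A x a b).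
have A'cof k b : cofactor (A' k) k b = cofactor (A x) k b.
  rewrite /cofactor; congr (_ * \det _); apply/matrixP => r c.
  by rewrite !mxE eq_sym (negbTE (neq_lift _ _)).
transitivity (\sum_k \det (A' k)).
  have dprod (s : 'S_m) := partial_prod i (fun a => dA a (s a)).
  rewrite (partial_sum _ _ _).1; last first.
    move=> s _; apply: differentiableM; first exact: differentiable_cst.
    exact: (dprod s).2.
  rewrite exchange_big/=; apply: eq_bigr => s _.
  rewrite partialM; [|exact: differentiable_cst|exact: (dprod s).2].
  rewrite partial_cst mul0r add0r (dprod s).1 big_distrr/=.
  apply: eq_bigr => k _; congr (_ * _); apply: eq_bigr => a _.
  by rewrite mxE.
rewrite /mxtrace; apply: eq_bigr => k _.
rewrite (expand_det_row _ k) mxE; apply: eq_bigr => b _.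
by rewrite A'cof !mxE eqxx.
Qed.

(** Cramer's rule makes the entries rational in those of [A]. As [invmx] returns its argument on
    singular matrices, the formula is available on [U] only. *)
Lemma smooth_on_invmx m U (A : 'rV[R]_n -> 'M[R]_m) : open U ->
  (forall a b, smooth_on U (fun x => A x a b)) ->
  (forall x, U x -> A x \in unitmx) ->
  forall a b, smooth_on U (fun x => invmx (A x) a b).
Proof.
move=> oU sA uA a b.
suff s : smooth_on U (fun x => (\det (A x))^-1 * ((-1) ^+ (b + a) *
    \det (row' b (col' a (A x))))).
  move=> k; apply: Ck_congr (s k) => // x Ux.
  by rewrite /invmx uA// !mxE.
apply: smooth_onM => //.
  apply: smooth_onV => //; last exact: smooth_on_det.
  by move=> x Ux; rewrite -unitfE -unitmxE uA.
apply: smooth_onM => //; first exact: smooth_on_cst.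
apply: smooth_on_det => // r c.
rewrite (_ : (fun x => _) = (fun x => A x (lift b r) (lift a c)))//.
by apply/funext => x; rewrite !mxE.
Qed.

(** Differentiate [A y *m invmx (A y) = 1%:M], an identity on the open set [U]. *)
Lemma partial_mx_invmx m U i (A : 'rV[R]_n -> 'M[R]_m) x : open U ->
  (forall a b, smooth_on U (fun x => A x a b)) ->
  (forall x, U x -> A x \in unitmx) -> U x ->
  partial_mx i (fun y => invmx (A y)) x =
  - (invmx (A x) *m partial_mx i A x *m invmx (A x)).
Proof.
move=> oU sA uA Ux.
have dA a b : differentiable (fun y => A y a b) x.
  exact: smooth_differentiable Ux.
have dV a b : differentiable (fun y => invmx (A y) a b) x.
  by apply: (@smooth_differentiable U) => //; exact: smooth_on_invmx.
have : partial_mx i (fun y => A y *m invmx (A y)) x = 0.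
  apply/matrixP => a b; rewrite !mxE.
  rewrite (@partial_congr U _ (fun _ => (1%:M : 'M[R]_m) a b))// ?partial_cst//.
  by move=> y Uy; rewrite mulmxV// uA.
rewrite partial_mxM// addrC => /eqP; rewrite addr_eq0 => /eqP AV.
by rewrite -mulmxA -mulmxN -AV mulKmx// uA.
Qed.

Lemma chain_rule m (F : 'rV[R]_n -> 'rV[R]_m) (g : 'rV[R]_m -> R) i x :
  (forall k, differentiable (fun z => F z 0 k) x) ->
  differentiable g (F x) ->
  partial i (fun z => g (F z)) x =
  \sum_k partial k g (F x) * partial i (fun z => F z 0 k) x.
Proof.
move=> dF dg.
(* Writing [F] through its coordinates and the standard basis derives its differentiability, and its
   differential, from the componentwise hypotheses. *)
have FE : F = \sum_k (fun z => F z 0 k *: (delta_mx 0 k : 'rV[R]_m)).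
  by apply/funext => z; rewrite fct_sumE [LHS]row_sum_delta.
have dZ k : differentiable (fun z => F z 0 k *: (delta_mx 0 k : 'rV[R]_m)) x.
  exact: differentiableZl.
have dF' : differentiable F x by rewrite FE; exact: differentiable_sum.
rewrite /partial deriveE; last exact: (differentiable_comp dF' dg).
rewrite (diff_comp dF' dg)/=.
have -> : 'd F x (delta_mx 0 i) =
    \sum_k partial i (fun z => F z 0 k) x *: (delta_mx 0 k : 'rV[R]_m).
  rewrite -deriveE// {1}FE derive_sum; last by move=> k; exact: diff_derivable.
  apply: eq_bigr => k _; rewrite deriveE// diffZl//= /partial deriveE//.
rewrite linear_sum/=; apply: eq_bigr => k _.
by rewrite linearZ /partial (deriveE (delta_mx 0 k) dg) mulrC.
Qed.

End SmoothFunctions.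

(** * Positive definite matrices *)

Section PositiveDefinite.
Variables (R : rcfType) (n : nat).

Definition posdef (S : 'M[R]_n) : Prop :=
  forall w : 'rV_n, w != 0 -> 0 < (w *m S *m w^T) 0 0.

(** A nonzero row of the kernel would be a vector at which the quadratic form vanishes. *)
Lemma posdef_unitmx (S : 'M[R]_n) : posdef S -> S \in unitmx.
Proof.
move=> S0; rewrite -row_free_unit -kermx_eq0.
apply/eqP/row_matrixP => i; rewrite row0; apply/eqP/negPn/negP => wi0.
have := S0 _ wi0; have /sub_kermxP -> := row_sub i (kermx S).
by rewrite mul0mx mxE ltxx.
Qed.

(* [det] has no zero on the segment from the identity to S, on which it is
   polynomial and equal to 1 at the identity. *)
Lemma posdef_det_gt0 (S : 'M[R]_n) : posdef S -> 0 < \det S.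
Proof.
move=> S0; pose P : 'M[{poly R}]_n :=
  \matrix_(i, j) ((i == j)%:R%:P + 'X * (S i j - (i == j)%:R)%:P).
pose A t : 'M[R]_n := 1%:M + t *: (S - 1%:M).
have PA t : (\det P).[t] = \det (A t).
  rewrite -horner_evalE -det_map_mx; congr (\det _).
  by apply/matrixP => i j; rewrite !mxE /= horner_evalE !hornerE.
have one0 (w : 'rV[R]_n) : w != 0 -> 0 < (w *m w^T) 0 0.
  move=> w0; have [i wi0] : exists i, w 0 i != 0.
    apply/existsP; apply: contraNT w0 => /existsPn w0.
    by apply/eqP/rowP => i; rewrite mxE; apply/eqP/negPn/w0.
  rewrite mxE (bigD1 i)//= mxE -expr2 ltr_pwDl ?exprn_even_gt0//.
  by apply: sumr_ge0 => j _; rewrite mxE -expr2 sqr_ge0.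
have A0 t : 0 <= t <= 1 -> \det (A t) != 0.
  move=> /andP[t0 t1]; rewrite -unitfE -unitmxE; apply: posdef_unitmx => w w0.
  have -> : A t = (1 - t) *: 1%:M + t *: S.
    by rewrite /A scalerBr scalerBl scale1r addrCA addrC.
  rewrite mulmxDr mulmxDl -!scalemxAr mulmx1 -!scalemxAl.
  rewrite mxE [X in X + _]mxE [X in _ + X]mxE.
  (* At [t = 1] the identity part disappears and [S] supplies strict positivity; for [t < 1] the
     identity part does, and the other term is nonnegative even at [t = 0]. *)
  move: t1; rewrite le_eqVlt => /predU1P[->|t1].
    by rewrite subrr mul0r add0r mul1r S0.
  by rewrite ltr_pwDl// ?mulr_gt0// ?subr_gt0 ?one0// mulr_ge0// ltW// S0.
have A1 : A 1 = S by rewrite /A scale1r addrC subrK.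
rewrite -A1 ltNge; apply/negP => S1.
(* If [\det S] were at most 0, [- \det P] would go from -1 at 0 to a nonnegative value at 1, so it
   would have a root on the segment. *)
have [|t t01 /rootP rt] := @poly_ivt R (- \det P) 0 1 ler01.
  by rewrite !hornerE !PA /A scale0r addr0 det1 lerN10 oppr_ge0; exact: S1.
by have := A0 t t01; rewrite -PA -oppr_eq0 -hornerN rt eqxx.
Qed.

(** The form of the inverse at [w] is the form of [S] at [w *m invmx S]; symmetry of [S] identifies
    the transposed inverse with the inverse. *)
Lemma posdef_inv (S : 'M[R]_n) : S^T = S -> posdef S -> posdef (invmx S).
Proof.
move=> St S0 w w0; have uS := posdef_unitmx S0.
have v0 : w *m invmx S != 0.
  by apply: contraNneq w0 => v0; rewrite -(mulmxKV uS w) v0 mul0mx.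
by have := S0 _ v0; rewrite mulmxKV// trmx_mul trmx_inv St mulmxA.
Qed.

End PositiveDefinite.

(** * Alternating forms, tuples and changes of coordinates *)

Section AlternatingForms.
Variables (R : realFieldType) (n : nat) (E : n.-tuple 'I_n -> R).
Hypothesis Ealt : forall (s : 'S_n) (J : n.-tuple 'I_n),
  E [tuple tnth J (s r) | r < n] = (-1) ^+ s * E J.

(** Exchanging the two equal indices fixes [J] and changes the sign, so [E J] equals its own
    opposite. *)
Lemma alternating_eq0 (J : n.-tuple 'I_n) i j :
  i != j -> tnth J i = tnth J j -> E J = 0.
Proof.
move=> ij Jij; have := Ealt (tperm i j) J; rewrite odd_tperm ij expr1 mulN1r.
have -> : [tuple tnth J (tperm i j r) | r < n] = J.
  by apply/eq_from_tnth => r; rewrite tnth_mktuple; case: tpermP => [->|->|].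
by move=> ?; lra.
Qed.

Lemma alternating_perm (s : 'S_n) :
  E [tuple s r | r < n] = (-1) ^+ s * E (ord_tuple n).
Proof.
rewrite -Ealt; congr E; apply/eq_from_tnth => r.
by rewrite !tnth_mktuple tnth_ord_tuple.
Qed.

Lemma noninjective_alternating_eq0 (J : n.-tuple 'I_n) :
  ~~ injectiveb (tnth J) -> E J = 0.
Proof.
move=> /injectivePn [i [j ij Jij]]; exact: alternating_eq0 ij Jij.
Qed.

Lemma injective_tuple_perm (J : n.-tuple 'I_n) : injectiveb (tnth J) ->
  exists s : 'S_n, J = [tuple s r | r < n].
Proof.
move=> /injectiveP Ji; exists (perm Ji).
by apply/eq_from_tnth => r; rewrite tnth_mktuple permE.
Qed.

Lemma alternating_neq0 (J : n.-tuple 'I_n) : E J != 0 -> E (ord_tuple n) != 0.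
Proof.
have [/injective_tuple_perm[s ->]|/noninjective_alternating_eq0->] :=
  boolP (injectiveb (tnth J)); last by rewrite eqxx.
by rewrite alternating_perm mulf_eq0 signr_eq0.
Qed.

(** Only injective tuples contribute, and these are permutations, so the sum is the Leibniz
    expansion. This is why a top-degree form transforms by the determinant of the Jacobian. *)
Lemma alternating_det (K : 'M[R]_n) :
  \sum_(B : n.-tuple 'I_n) (\prod_(r < n) K (tnth B r) r) * E B =
  \det K * E (ord_tuple n).
Proof.
rewrite (bigID (fun B : n.-tuple 'I_n => injectiveb (tnth B)))/=.
rewrite [X in _ + X]big1 ?addr0; last first.
  by move=> B /noninjective_alternating_eq0 ->; rewrite mulr0.
pose h (s : 'S_n) := [tuple s r | r < n].
have hinj : injective h.
  move=> s t st; apply/permP => r.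
  by have := congr1 (fun B => tnth B r) st; rewrite !tnth_mktuple.
have hP B : (B \in h @: predT) = injectiveb (tnth B).
  apply/imsetP/idP => [[s _ ->]|/injective_tuple_perm[s ->]]; last by exists s.
  by apply/injectiveP => i j; rewrite !tnth_mktuple; exact: perm_inj.
under eq_bigl do rewrite -hP.
rewrite big_imset/=; last by move=> s t _ _; exact: hinj.
(* The permutation acts on the row index of [K], whereas the definition of [\det] permutes columns;
   hence the transpose. *)
rewrite -det_tr big_distrl/=; apply: eq_big => [//|s _].
rewrite alternating_perm mulrA [_ * (-1) ^+ s]mulrC; congr (_ * _ * _).
by apply: eq_bigr => r _; rewrite tnth_mktuple mxE.
Qed.

(** Replacing index [s] by some other [m] creates a repetition, so only [m = s] survives. A
    connection thus acts on a top-degree form through the trace of its Christoffel matrix. *)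
Lemma alternating_tset_trace (G : 'I_n -> 'I_n -> R) :
  \sum_(s < n) \sum_(m < n) G m s * E (tset (ord_tuple n) s m) =
  (\sum_(s < n) G s s) * E (ord_tuple n).
Proof.
rewrite big_distrl/=; apply: eq_bigr => s _.
rewrite (bigD1 s)//= [X in _ + X]big1 ?addr0; last first.
  move=> m ms; rewrite (@alternating_eq0 _ m s) ?mulr0//.
  by rewrite !tnth_mktuple eqxx (negbTE ms) tnth_ord_tuple.
congr (_ * E _); apply/eq_from_tnth => r; rewrite tnth_mktuple.
by case: eqP => // ->; rewrite tnth_ord_tuple.
Qed.

End AlternatingForms.

Section TupleSums.
Variables (T : finType) (V : nmodType).

Lemma sum_tuple0 (F : 0.-tuple T -> V) : \sum_A F A = F [tuple].
Proof.
rewrite (bigD1 [tuple])//= big1 ?addr0// => A /eqP[]; exact: tuple0.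
Qed.

Lemma sum_tuple1 (F : 1.-tuple T -> V) : \sum_A F A = \sum_a F [tuple a].
Proof.
rewrite (reindex (fun a => [tuple a]))//=.
exists (fun A => thead A) => [a _|A _]; first by [].
by case/tupleP: A => a A; rewrite (tuple0 A) theadE; apply/val_inj.
Qed.

Lemma sum_tuple2 (F : 2.-tuple T -> V) :
  \sum_A F A = \sum_a \sum_b F [tuple a; b].
Proof.
rewrite pair_bigA/= (reindex (fun p : T * T => [tuple p.1; p.2]))//=.
exists (fun A => (tnth A ord0, tnth A ord_max)) => [[a b] _|A _]; first by [].
by apply/eq_from_tnth => -[[|[|//]] i]; rewrite /tnth/=; apply: set_nth_default;
  rewrite size_tuple.
Qed.

End TupleSums.

Section ChangeOfCoordinates.
Variables (R : realType) (n : nat).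

Lemma partial_coord (i k : 'I_n) (x : 'rV[R]_n) :
  partial i (fun z => z 0 k) x = (k == i)%:R.
Proof.
have dx : derivable (@id 'rV[R]_n) x (delta_mx 0 i) by exact: derivable_id.
have := derive_mx dx; rewrite derive_id => /rowP/(_ k).
rewrite !mxE eqxx/= /partial => ->.
by [].
Qed.

(** This is the chain rule for the round trip from [c] to [c'] and back, which is the identity only
    near the point. *)
Lemma jacobian_mulV (M : topologicalType) (c c' : chart R n M) u :
  compatible c c' -> cdom c u -> cdom c' u ->
  Defs.jacobian c' c (cmap c' u) *m Defs.jacobian c c' (cmap c u) = 1%:M.
Proof.
move=> cc' cu c'u; apply/matrixP => k i; rewrite !mxE.
pose F z := cmap c' (cinv c z).
have Fx : F (cmap c u) = cmap c' u by rewrite /F cmapK.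
have d1 m : differentiable (fun z => F z 0 m) (cmap c u).
  by have [+ _] := cc' m; move=> /smooth_differentiable; apply; exists u.
have d2 m : differentiable (transition c' c m) (F (cmap c u)).
  by have [_] := cc' m; move=> /smooth_differentiable; apply; rewrite Fx; exists u.
have := chain_rule i d1 (d2 k); rewrite Fx.
under eq_bigr do rewrite -/(transition c c' _).
move=> H; transitivity (partial i (fun z => transition c' c k (F z)) (cmap c u)).
  by rewrite H; apply: eq_bigr => m _; rewrite !mxE.
rewrite -(partial_coord i k (cmap c u)); apply: near_eq_derive.
have cx : cimg c (cmap c u) by exists u.
have nc : \forall z \near cmap c u, cimg c z.
  by apply: open_nbhs_nbhs; split => //; exact: cimg_open.
(* Continuity of [cinv c] keeps nearby points inside the domain of [c'], where the round trip really
   cancels. *)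
have nc' : \forall z \near cmap c u, cdom c' (cinv c z).
  apply: (cinv_continuous cx); rewrite /= cmapK//.
  by apply: open_nbhs_nbhs; split => //; exact: cdom_open.
near=> z; have [w cw zw] : cimg c z by near: z.
have : cdom c' (cinv c z) by near: z.
by rewrite /transition /F -zw cmapK// => c'w; rewrite cmapK.
Unshelve. all: by end_near. Qed.

End ChangeOfCoordinates.

(** * Tensor fields in coordinates *)

Section TensorComponents.
Variables (R : realType) (n : nat) (M : manifold R n).
Local Notation chart := (chart R n M).
Local Notation jac := Defs.jacobian.

Definition contravariant_mx (h : tensor M 2 0) (c : chart) x : 'M[R]_n :=
  \matrix_(a, b) h c [tuple a; b] [tuple] x.

Definition vector_col (X : vector_field M) (c : chart) x : 'cV[R]_n :=
  \col_a X c [tuple a] [tuple] x.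

(** For an alternating tensor this single component determines all the others, so a volume form
    becomes one scalar function per chart. *)
Definition top_comp (e : tensor M 0 n) (c : chart) x : R :=
  e c [tuple] (ord_tuple n) x.

Lemma cimg_cmap (c : chart) u : cdom c u -> cimg c (cmap c u).
Proof. by exists u. Qed.

Section Law.
Variables (c c' : chart) (u : M).
Hypotheses (ac : atlas M c) (ac' : atlas M c') (cu : cdom c u) (c'u : cdom c' u).
Local Notation x := (cmap c u).
Local Notation y := (cmap c' u).

Lemma jacobianV : jac c' c y *m jac c c' x = 1%:M.
Proof. by apply: jacobian_mulV => //; exact: atlas_compatible. Qed.

Lemma contravariant_mx_law (h : tensor M 2 0) :
  contravariant_mx h c' y = jac c c' x *m contravariant_mx h c x *m (jac c c' x)^T.
Proof.
apply/matrixP => a b; rewrite !mxE (tensor_law _ ac ac' cu c'u) sum_tuple2.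
rewrite exchange_big/=; apply: eq_bigr => j _.
rewrite !mxE big_distrl/=; apply: eq_bigr => i _.
rewrite sum_tuple0 !big_ord_recl !big_ord0 !(tnth_nth i)/= !mxE.
ring.
Qed.

Lemma vector_col_law (X : vector_field M) :
  vector_col X c' y = jac c c' x *m vector_col X c x.
Proof.
apply/matrixP => a b; rewrite !mxE (tensor_law _ ac ac' cu c'u) sum_tuple1.
apply: eq_bigr => i _.
rewrite sum_tuple0 !big_ord_recl !big_ord0 !(tnth_nth i)/= !mxE.
ring.
Qed.

Lemma top_comp_law (e : tensor M 0 n) : Defs.alternating e ->
  top_comp e c' y = \det (jac c' c y) * top_comp e c x.
Proof.
move=> ealt; rewrite /top_comp (tensor_law _ ac ac' cu c'u) sum_tuple0.
rewrite -[RHS](@alternating_det _ _ (fun J => e c [tuple] J _)); last first.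
  by move=> s J; exact: ealt ac _ (cimg_cmap cu) s J.
apply: eq_bigr => B _; rewrite big_ord0 mul1r; congr (_ * _).
by apply: eq_bigr => r _; rewrite tnth_ord_tuple.
Qed.

End Law.

(** Serves to turn the chartwise formula for the potential into a global field;
    [covariant_tensor_of_mx] does the same for the rescaled metric. *)
Lemma one_form_of_col (A : chart -> 'rV[R]_n -> 'cV[R]_n) :
  (forall c, atlas M c -> forall a, smooth_on (cimg c) (fun x => A c x a 0)) ->
  (forall c c', atlas M c -> atlas M c' -> forall u, cdom c u -> cdom c' u ->
    A c' (cmap c' u) = (jac c' c (cmap c' u))^T *m A c (cmap c u)) ->
  exists Y : one_form M, forall c a x, Y c [tuple] [tuple a] x = A c x a 0.
Proof.
move=> sA lA.
pose T (c : chart) (I : 0.-tuple 'I_n) (J : 1.-tuple 'I_n) x :=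
  A c x (tnth J ord0) 0.
have sT c : atlas M c -> forall I J, smooth_on (cimg c) (T c I J).
  by move=> ac I J; exact: sA.
unshelve eexists (Tensor sT _); last by [].
move=> c c' ac ac' u cu c'u x y I J; rewrite /T (lA c c')// mxE.
rewrite sum_tuple0 sum_tuple1; apply: eq_bigr => i _.
by rewrite big_ord0 mul1r big_ord_recl big_ord0 mulr1 mxE.
Qed.

Lemma covariant_tensor_of_mx (A : chart -> 'rV[R]_n -> 'M[R]_n) :
  (forall c, atlas M c -> forall a b, smooth_on (cimg c) (fun x => A c x a b)) ->
  (forall c c', atlas M c -> atlas M c' -> forall u, cdom c u -> cdom c' u ->
    A c' (cmap c' u) =
    (jac c' c (cmap c' u))^T *m A c (cmap c u) *m jac c' c (cmap c' u)) ->
  exists g : tensor M 0 2, forall c a b x,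
    g c [tuple] [tuple a; b] x = A c x a b.
Proof.
move=> sA lA.
pose T (c : chart) (I : 0.-tuple 'I_n) (J : 2.-tuple 'I_n) x :=
  A c x (tnth J ord0) (tnth J ord_max).
have sT c : atlas M c -> forall I J, smooth_on (cimg c) (T c I J).
  by move=> ac I J; exact: sA.
unshelve eexists (Tensor sT _); last by [].
move=> c c' ac ac' u cu c'u x y I J; rewrite /T (lA c c')// mxE.
rewrite sum_tuple0 sum_tuple2 exchange_big/=; apply: eq_bigr => j _.
rewrite mxE big_distrl/=; apply: eq_bigr => i _.
have -> : ord_max = lift ord0 ord0 :> 'I_2 by apply/val_inj.
by rewrite big_ord0 mul1r !big_ord_recl big_ord0 mulr1 mxE mulrAC.
Qed.

(** The added term is a tensor, and a connection plus a tensor of this type obeys the law of a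
    connection. *)
Lemma projective_change (D : connection M) (Y : one_form M) :
  exists D' : connection M, forall c k i j x,
    D' c k i j x = D c k i j x + ((k == j)%:R * Y c [tuple] [tuple i] x +
                                  (k == i)%:R * Y c [tuple] [tuple j] x).
Proof.
pose T (c : chart) k i j x :=
  D c k i j x + ((k == j)%:R * Y c [tuple] [tuple i] x +
                 (k == i)%:R * Y c [tuple] [tuple j] x).
have sT c : atlas M c -> forall k i j, smooth_on (cimg c) (T c k i j).
  move=> ac k i j; have oc : open (cimg c) by exact: cimg_open.
  apply: smooth_onD => //; first exact: christoffel_smooth.
  by apply: smooth_onD => //; apply: smooth_onM => //;
    first [exact: smooth_on_cst|exact: tensor_smooth].
unshelve eexists (Connection sT _); last by [].
move=> c c' ac ac' u cu c'u x y k i j; rewrite /T.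
rewrite (christoffel_law D ac ac' cu c'u) -/x -/y.
have YE l : Y c' [tuple] [tuple l] y =
    \sum_m jac c' c y m l * Y c [tuple] [tuple m] x.
  rewrite (tensor_law _ ac ac' cu c'u) sum_tuple0 sum_tuple1.
  by apply: eq_bigr => m _; rewrite big_ord0 mul1r big_ord_recl big_ord0 mulr1.
have JK l : \sum_m jac c c' x k m * jac c' c y m l = (k == l)%:R.
  have /matrixP/(_ k l) := jacobianV ac' ac c'u cu; rewrite !mxE => <-.
  by [].
(* The inhomogeneous term with second derivatives is common to both sides; the homogeneous parts
   remain. *)
rewrite addrAC; congr (_ + _).
pose F k1 i1 j1 := jac c c' x k k1 * jac c' c y i1 i * jac c' c y j1 j.
(* By [JK] each Kronecker delta is a product of the two Jacobians, which puts the correction in the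
   form of the homogeneous law. *)
have -> : (k == j)%:R * Y c' [tuple] [tuple i] y +
          (k == i)%:R * Y c' [tuple] [tuple j] y =
  \sum_k1 \sum_i1 \sum_j1 F k1 i1 j1 *
    ((k1 == j1)%:R * Y c [tuple] [tuple i1] x +
     (k1 == i1)%:R * Y c [tuple] [tuple j1] x).
  rewrite -!JK !YE !big_distrl -big_split/=; apply: eq_bigr => k1 _.
  transitivity (\sum_i1 F k1 i1 k1 * Y c [tuple] [tuple i1] x
      + \sum_j1 F k1 k1 j1 * Y c [tuple] [tuple j1] x).
    by rewrite !big_distrr/=; congr (_ + _); apply: eq_bigr => m _; rewrite /F; ring.
  under [RHS]eq_bigr do (under eq_bigr do rewrite mulrDr); rewrite /=.
  under [RHS]eq_bigr do rewrite big_split; rewrite big_split/=; congr (_ + _).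
    apply: eq_bigr => i1 _; rewrite (bigD1 k1)//= (eqxx k1) mul1r big1 ?addr0// => j1.
    by rewrite eq_sym => /negbTE ->; rewrite mul0r mulr0.
  rewrite [RHS](bigD1 k1)//= [X in _ = _ + X]big1 ?addr0.
    by apply: eq_bigr => j1 _; rewrite (eqxx k1) mul1r.
  move=> i1; rewrite eq_sym => /negbTE ->.
  by rewrite big1// => j1 _; rewrite mul0r mulr0.
rewrite -big_split/=; apply: eq_bigr => k1 _.
rewrite -big_split/=; apply: eq_bigr => i1 _.
rewrite -big_split/=; apply: eq_bigr => j1 _.
by rewrite -mulrDr.
Qed.

End TensorComponents.

(** * The rescaled inverse of sigma and covariant derivatives *)

Section RescaledInverse.
Variables (R : realType) (n : nat) (U : set 'rV[R]_n) (x : 'rV[R]_n).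
Variables (S : 'rV[R]_n -> 'M[R]_n) (f : 'rV[R]_n -> R).
Hypotheses (oU : open U) (Ux : U x).
Hypotheses (sS : forall a b, smooth_on U (fun y => S y a b)).
Hypotheses (uS : forall y, U y -> S y \in unitmx) (St : (S x)^T = S x).
Hypotheses (sf : smooth_on U f) (f0 : forall y, U y -> f y != 0).

Definition rescaling y : R := f y ^+ 2 * \det (S y).

Lemma rescaling_neq0 y : U y -> rescaling y != 0.
Proof.
by move=> Uy; rewrite mulf_neq0 ?expf_neq0 ?f0// -unitfE -unitmxE uS.
Qed.

Lemma smooth_rescaling : smooth_on U rescaling.
Proof. by apply: smooth_onM => //; [exact: smooth_onM|exact: smooth_on_det]. Qed.

Lemma smooth_rescaled_invmx a b :
  smooth_on U (fun y => ((rescaling y)^-1 *: invmx (S y)) a b).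
Proof.
rewrite (_ : (fun y => _) = fun y => (rescaling y)^-1 * invmx (S y) a b).
  apply: smooth_onM => //; last exact: smooth_on_invmx.
  by apply: smooth_onV => //; [exact: rescaling_neq0|exact: smooth_rescaling].
by apply/funext => y; rewrite mxE.
Qed.

(** In the application [G] is the Christoffel matrix in direction [a] and [v] the column of [mu].
    Then [dS] is the equation on sigma and [df] the parallelism of the volume form, both solved for
    the ordinary derivative. *)
Variables (a : 'I_n) (G : 'M[R]_n) (v : 'cV[R]_n).
Local Notation ea := (delta_mx a 0 : 'cV[R]_n).
Local Notation nu := (invmx (S x) *m v).
Hypothesis dS : partial_mx a S x =
  ea *m v^T + v *m ea^T - G *m S x - S x *m G^T.
Hypothesis df : partial a f x = \tr G * f x.

Lemma trmx_nu : nu^T = v^T *m invmx (S x).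
Proof. by rewrite trmx_mul trmx_inv St. Qed.

(** By [dS], the logarithmic derivative of [\det (S y)] is $2\nu_a-2\,\mathrm{tr}\,G$: the two
    rank-one terms each give $\nu_a$ and the two Christoffel terms each give $-\mathrm{tr}\,G$. The
    square of [f] contributes exactly the missing $2\,\mathrm{tr}\,G$. *)
Lemma partial_rescaling : partial a rescaling x = 2 * nu a 0 * rescaling x.
Proof.
have dSx r c : differentiable (fun y => S y r c) x.
  exact: smooth_differentiable Ux.
have dfx : differentiable f x by exact: smooth_differentiable Ux.
rewrite /rescaling partialM; last 2 first.
- exact: differentiableM.
- by apply: (@smooth_differentiable _ _ U) => //; exact: smooth_on_det.
rewrite (_ : (fun y => f y ^+ 2) = fun y => f y * f y)// partialM//.
rewrite partial_det// df.
have -> : \adj (S x) = \det (S x) *: invmx (S x).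
  by rewrite /invmx uS// scalerA divff ?scale1r// -unitfE -unitmxE uS.
rewrite -scalemxAr mxtraceZ dS !mulmxBl mulmxDl !raddfB raddfD/=.
rewrite -!mulmxA -trmx_nu.
rewrite mulmxV ?uS// mulmx1 (mxtrace_mulC (S x)) -mulmxA mulVmx ?uS// mulmx1.
rewrite mxtrace_tr (mxtrace_mulC v) -mulmxA.
rewrite (mxtrace_mulC ea).
have trE (w : 'cV[R]_n) : \tr (w^T *m ea) = w a 0.
  by rewrite trace_mx11 -colE !mxE.
have trE' (w : 'cV[R]_n) : \tr (ea^T *m w) = w a 0.
  by rewrite -mxtrace_tr trmx_mul trmxK trE.
rewrite trE trE'.
ring.
Qed.

(** [G'] is the Christoffel matrix of the changed connection, so the equation says that [g] is
    parallel for it. Inverting [S] turns the rank-one terms of [dS] into those of [G'], and the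
    derivative of the scalar factor yields the two multiples of [nu a 0]. *)
Lemma partial_rescaled_invmx :
  let G' := G - (nu a 0)%:M - ea *m nu^T in
  let g := fun y => (rescaling y)^-1 *: invmx (S y) in
  partial_mx a g x = G'^T *m g x + g x *m G'.
Proof.
move=> G' g.
have dr : differentiable rescaling x.
  by apply: smooth_differentiable Ux; exact: smooth_rescaling.
have dI r c : differentiable (fun y => invmx (S y) r c) x.
  by apply: (@smooth_differentiable _ _ U) => //; exact: smooth_on_invmx.
have r0 := rescaling_neq0 Ux.
have -> : partial_mx a g x =
    - (2 * nu a 0) *: g x + (rescaling x)^-1 *: partial_mx a (fun y => invmx (S y)) x.
  apply/matrixP => r c; rewrite !mxE.
  rewrite (_ : (fun y => g y r c) = fun y => (rescaling y)^-1 * invmx (S y) r c).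
    rewrite partialM// ?partialV//; last exact: differentiableV.
    by rewrite partial_rescaling [nu a 0]mxE; field.
  by apply/funext => y; rewrite mxE.
rewrite (partial_mx_invmx a oU sS uS Ux) dS.
have IV : invmx (S x) *m (ea *m v^T + v *m ea^T - G *m S x - S x *m G^T) *m
    invmx (S x) = invmx (S x) *m ea *m nu^T + nu *m ea^T *m invmx (S x) -
    invmx (S x) *m G - G^T *m invmx (S x).
  rewrite !mulmxBr !mulmxBl mulmxDr mulmxDl trmx_nu !mulmxA.
  rewrite mulVmx ?uS// mul1mx; congr (_ - _ - _).
  by rewrite -mulmxA mulmxV ?uS// mulmx1.
rewrite IV /g -scalemxAl -scalemxAr -scalerDr.
rewrite scalerA [_ * (rescaling x)^-1]mulrC -scalerA -scalerDr; congr (_ *: _).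
rewrite /G' !linearB/= tr_scalar_mx [(ea *m _)^T]trmx_mul trmxK !mulmxBl.
rewrite mul_scalar_mx mul_mx_scalar mulmxA.
(* With the two rank-one products made opaque, the identity is linear and can be checked
   entrywise. *)
move: (_ *m ea *m _) (nu *m _ *m _) => A B.
apply/matrixP => r c; rewrite !mxE; ring.
Qed.

End RescaledInverse.

Section CovariantDerivativeComponents.
Variables (R : realType) (n : nat) (M : manifold R n) (D : connection M).
Local Notation chart := (chart R n M).

(** With the derivative index fixed, this is the endomorphism by which the connection corrects the
    partial derivative of a vector. *)
Definition christoffel_mx (c : chart) (a : 'I_n) x : 'M[R]_n :=
  \matrix_(b, m) D c b a m x.

Lemma tset_tuple1 (T : 'I_n) (m : 'I_n) : tset [tuple T] ord0 m = [tuple m].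
Proof. by apply/eq_from_tnth => r; rewrite tnth_mktuple (ord1 r). Qed.

Lemma tset_tuple2l (b d m : 'I_n) : tset [tuple b; d] ord0 m = [tuple m; d].
Proof.
by apply/eq_from_tnth => r; rewrite tnth_mktuple; case: r => [[|[|//]] i].
Qed.

Lemma tset_tuple2r (b d m : 'I_n) :
  tset [tuple b; d] (lift ord0 ord0) m = [tuple b; m].
Proof.
by apply/eq_from_tnth => r; rewrite tnth_mktuple; case: r => [[|[|//]] i].
Qed.

Lemma nabla_vector_field (X : vector_field M) (c : chart) a b x :
  nabla D X c a [tuple b] [tuple] x =
  partial a (X c [tuple b] [tuple]) x +
  \sum_m D c b a m x * X c [tuple m] [tuple] x.
Proof.
rewrite /nabla big_ord0 subr0 big_ord_recl big_ord0 addr0; congr (_ + _).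
by apply: eq_bigr => m _; rewrite tset_tuple1.
Qed.

Lemma nabla_contravariant (h : tensor M 2 0) (c : chart) a b d x :
  nabla D h c a [tuple b; d] [tuple] x =
  (partial_mx a (contravariant_mx h c) x +
   christoffel_mx c a x *m contravariant_mx h c x +
   contravariant_mx h c x *m (christoffel_mx c a x)^T) b d.
Proof.
rewrite /nabla big_ord0 subr0 !big_ord_recl big_ord0 addr0 !mxE addrA.
rewrite (_ : (fun y => contravariant_mx h c y b d) = h c [tuple b; d] [tuple]).
  congr (_ + _ + _); apply: eq_bigr => m _; rewrite !mxE.
    by rewrite tset_tuple2l.
  by rewrite tset_tuple2r mulrC.
by apply/funext => y; rewrite mxE.
Qed.

Lemma nabla_covariant (g : tensor M 0 2) (A : 'rV[R]_n -> 'M[R]_n) (c : chart) a b d x :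
  (forall b d y, g c [tuple] [tuple b; d] y = A y b d) ->
  nabla D g c a [tuple] [tuple b; d] x =
  (partial_mx a A x -
   ((christoffel_mx c a x)^T *m A x + A x *m christoffel_mx c a x)) b d.
Proof.
move=> gA.
rewrite /nabla big_ord0 addr0 !big_ord_recl big_ord0 addr0 !mxE.
rewrite (_ : (fun y => A y b d) = g c [tuple] [tuple b; d]).
  congr (_ - (_ + _)); apply: eq_bigr => m _; rewrite !mxE -gA.
    by rewrite tset_tuple2l.
  by rewrite tset_tuple2r mulrC.
by apply/funext => y; rewrite gA.
Qed.

Lemma nabla_top (e : tensor M 0 n) (c : chart) a x : atlas M c -> cimg c x ->
  Defs.alternating e ->
  nabla D e c a [tuple] (ord_tuple n) x =
  partial a (top_comp e c) x -
  (\sum_s D c s a s x) * top_comp e c x.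
Proof.
move=> ac cx ealt; rewrite /nabla big_ord0 addr0; congr (_ - _).
rewrite -(@alternating_tset_trace _ _ (fun J => e c [tuple] J x) _
  (fun m s => D c m a s x)); last by move=> s J; exact: ealt.
by apply: eq_bigr => s _; apply: eq_bigr => m _; rewrite tnth_ord_tuple.
Qed.

End CovariantDerivativeComponents.

(** * The metric connection *)

Section MetricConnection.
Variables (R : realType) (n : nat) (M : manifold R n) (D : connection M).
Variables (e : tensor M 0 n) (sigma : tensor M 2 0) (mu : vector_field M).
Hypotheses (D_torsion_free : torsion_free D).
Hypotheses (e_volume : volume_form e) (e_parallel : parallel D e).
Hypothesis sigma_metric : contravariant_riemannian_metric sigma.
Hypothesis sigma_eq : forall c, atlas M c -> forall x, cimg c x ->
  forall a b d : 'I_n, nabla D sigma c a [tuple b; d] [tuple] x =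
    (a == b)%:R * mu c [tuple d] [tuple] x +
    (a == d)%:R * mu c [tuple b] [tuple] x.

Local Notation chart := (chart R n M).
Local Notation S := (contravariant_mx sigma).
Local Notation f := (top_comp e).
Local Notation s c := (rescaling (S c) (f c)).
Local Notation nu c x := (invmx (S c x) *m vector_col mu c x).
Local Notation jac := Defs.jacobian.

Lemma open_cimg (c : chart) : open (cimg c).
Proof. exact: cimg_open. Qed.

Lemma smooth_contravariant_mx (c : chart) : atlas M c ->
  forall a b, smooth_on (cimg c) (fun x => S c x a b).
Proof.
move=> ac a b; rewrite (_ : (fun x => _) = sigma c [tuple a; b] [tuple]).
  exact: tensor_smooth.
by apply/funext => x; rewrite mxE.
Qed.

Lemma trmx_contravariant_mx (c : chart) x : atlas M c -> cimg c x ->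
  (S c x)^T = S c x.
Proof.
move=> ac cx; have [sym _] := sigma_metric ac cx.
by apply/matrixP => a b; rewrite !mxE sym.
Qed.

Lemma posdef_contravariant_mx (c : chart) x : atlas M c -> cimg c x ->
  posdef (S c x).
Proof.
move=> ac cx w w0; have [_ /(_ _ w0)] := sigma_metric ac cx.
congr (_ < _); rewrite mxE exchange_big/=; apply: eq_bigr => b _.
rewrite mxE big_distrl/=; apply: eq_bigr => a _.
by rewrite !mxE; ring.
Qed.

(** Nonvanishing provides some nonzero component; alternation moves this to the ordered one. *)
Lemma top_comp_neq0 (c : chart) x : atlas M c -> cimg c x -> f c x != 0.
Proof.
move=> ac cx; have [ealt e0] := e_volume.
have [I [J]] := e0 _ ac _ cx; rewrite (tuple0 I).
by apply: (@alternating_neq0 _ _ (fun J => e c [tuple] J x)) => r K; exact: ealt.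
Qed.

Lemma contravariant_mx_unit (c : chart) : atlas M c ->
  forall x, cimg c x -> S c x \in unitmx.
Proof. by move=> ac x cx; apply: posdef_unitmx; exact: posdef_contravariant_mx. Qed.

Lemma rescaling_gt0 (c : chart) x : atlas M c -> cimg c x -> 0 < s c x.
Proof.
move=> ac cx; apply: mulr_gt0.
  by rewrite exprn_even_gt0//= top_comp_neq0.
by apply: posdef_det_gt0; exact: posdef_contravariant_mx.
Qed.

Section Law.
Variables (c c' : chart) (u : M).
Hypotheses (ac : atlas M c) (ac' : atlas M c') (cu : cdom c u) (c'u : cdom c' u).
Local Notation x := (cmap c u).
Local Notation y := (cmap c' u).

Lemma invmx_contravariant_law :
  invmx (S c' y) = (jac c' c y)^T *m invmx (S c x) *m jac c' c y.
Proof.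
have JK := jacobianV ac' ac c'u cu.
have KJ := jacobianV ac ac' cu c'u.
have uS := contravariant_mx_unit ac (cimg_cmap cu).
have uS' := contravariant_mx_unit ac' (cimg_cmap c'u).
apply: (can_inj (mulKmx uS')); rewrite mulmxV//.
rewrite (contravariant_mx_law ac ac' cu c'u) -!mulmxA.
rewrite (mulmxA _^T) -trmx_mul KJ trmx1 mul1mx (mulmxA (S c x)).
by rewrite mulmxV// mul1mx JK.
Qed.

(** [f] is multiplied by the determinant of one Jacobian and [\det S] by the square of the
    determinant of its inverse, so [f ^+ 2] has exactly the opposite weight. *)
Lemma rescaling_law : s c' y = s c x.
Proof.
have KJ := congr1 determinant (jacobianV ac ac' cu c'u).
have [ealt _] := e_volume.
rewrite /rescaling (contravariant_mx_law ac ac' cu c'u).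
rewrite (top_comp_law ac ac' cu c'u ealt).
move: KJ; rewrite !det_mulmx det1 det_tr => KJ.
transitivity ((\det (jac c' c y) * \det (jac c c' x)) ^+ 2 *
  (f c x ^+ 2 * \det (S c x))); first by ring.
by rewrite KJ expr1n mul1r.
Qed.

Lemma potential_law : nu c' y = (jac c' c y)^T *m nu c x.
Proof.
rewrite invmx_contravariant_law (vector_col_law ac ac' cu c'u) -!mulmxA.
by rewrite (mulmxA (jac c' c y)) (jacobianV ac ac' cu c'u) mul1mx.
Qed.

End Law.

Lemma rescaled_metric_exists : exists g : tensor M 0 2, forall c a b x,
  g c [tuple] [tuple a; b] x = ((s c x)^-1 *: invmx (S c x)) a b.
Proof.
apply: (@covariant_tensor_of_mx _ _ _ (fun c x => (s c x)^-1 *: invmx (S c x))).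
  move=> c ac a b; apply: smooth_rescaled_invmx.
  - exact: open_cimg.
  - exact: smooth_contravariant_mx.
  - exact: contravariant_mx_unit.
  - exact: tensor_smooth.
  - by move=> x cx; exact: top_comp_neq0.
move=> c c' ac ac' u cu c'u.
rewrite (rescaling_law ac ac' cu c'u) (invmx_contravariant_law ac ac' cu c'u).
by rewrite -scalemxAr -scalemxAl.
Qed.

Lemma potential_exists : exists Y : one_form M, forall c a x,
  Y c [tuple] [tuple a] x = - nu c x a 0.
Proof.
have [Y YE] : exists Y : one_form M, forall c a x,
    Y c [tuple] [tuple a] x = (- nu c x) a 0.
  apply: (@one_form_of_col _ _ _ (fun c x => - nu c x)).
    move=> c ac a.
    rewrite (_ : (fun x => _) = fun x =>
        - \sum_b invmx (S c x) a b * mu c [tuple b] [tuple] x).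
      have oc : open (cimg c) := @open_cimg c.
      apply: smooth_onN => //; apply: smooth_on_sum => // b _.
      apply: smooth_onM => //; last exact: tensor_smooth.
      apply: smooth_on_invmx => //; first exact: smooth_contravariant_mx.
      exact: contravariant_mx_unit.
    apply/funext => x; rewrite !mxE; congr (- _); apply: eq_bigr => b _.
    by rewrite !mxE.
  move=> c c' ac ac' u cu c'u.
  by rewrite (potential_law ac ac' cu c'u) mulmxN.
by exists Y => c a x; rewrite YE mxE.
Qed.

Lemma partial_contravariant_mx (c : chart) x a : atlas M c -> cimg c x ->
  partial_mx a (S c) x =
  (delta_mx a 0 : 'cV_n) *m (vector_col mu c x)^T +
  vector_col mu c x *m (delta_mx a 0 : 'cV_n)^T -
  christoffel_mx D c a x *m S c x - S c x *m (christoffel_mx D c a x)^T.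
Proof.
move=> ac cx; apply/eqP; rewrite -subr_eq opprK -subr_eq opprK; apply/eqP.
rewrite addrAC; apply/matrixP => b d.
rewrite -nabla_contravariant sigma_eq// !mxE !big_ord1 !mxE.
move: (mu c [tuple d] _ x) (mu c [tuple b] _ x) => mu_d mu_b.
rewrite eqxx !andbT.
by rewrite [b == a]eq_sym [d == a]eq_sym [_ * (a == d)%:R]mulrC.
Qed.

Lemma partial_top_comp (c : chart) x a : atlas M c -> cimg c x ->
  partial a (f c) x = \tr (christoffel_mx D c a x) * f c x.
Proof.
move=> ac cx; have [ealt _] := e_volume.
have := e_parallel ac cx a [tuple] (ord_tuple n).
rewrite nabla_top// => /eqP; rewrite subr_eq0 => /eqP ->.
by congr (_ * _); apply: eq_bigr => b _; rewrite mxE.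
Qed.

Lemma projectively_metric : exists D' : connection M,
  metric_connection D' /\ projectively_equivalent D D'.
Proof.
have [g gE] := rescaled_metric_exists.
have [Y YE] := potential_exists.
have [D' D'E] := projective_change D Y.
exists D'; split; last first.
  exists Y => X c ac x cx a b; rewrite !nabla_vector_field -!addrA; congr (_ + _).
  under eq_bigr do rewrite D'E mulrDl; rewrite big_split/=; congr (_ + _).
  under eq_bigr do rewrite mulrDl; rewrite big_split/=; congr (_ + _).
    rewrite (bigD1 b)//= [X in _ + X]big1 ?addr0 ?(eqxx b) ?mul1r// => m.
    by rewrite eq_sym => /negbTE ->; rewrite !mul0r.
  by rewrite big_distrr/=; apply: eq_bigr => d _; rewrite eq_sym mulrA.
exists g; split.
  move=> c ac x cx; have s0 := rescaling_gt0 ac cx.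
  have pS := posdef_contravariant_mx ac cx.
  have tS := trmx_contravariant_mx ac cx.
  split=> [a b|v v0].
    by rewrite !gE -[in LHS]tS -trmx_inv !mxE.
  have := posdef_inv tS pS v0; rewrite -(pmulr_rgt0 _ (_ : 0 < (s c x)^-1)) ?invr_gt0//.
  congr (_ < _); rewrite mxE big_distrr exchange_big/=; apply: eq_bigr => b _.
  rewrite mxE big_distrl/= big_distrr/=; apply: eq_bigr => a _.
  by rewrite gE !mxE; ring.
split=> [c ac x cx k i j|c ac x cx a I J].
  (* The projective correction is symmetric in the lower indices, so the torsion of [D'] is that of
     [D]. *)
  rewrite !D'E opprD addrACA (D_torsion_free ac cx) add0r.
  by rewrite [X in _ - X]addrC subrr.
rewrite (tuple0 I).
have [b [d ->]] : exists b d, J = [tuple b; d].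
  exists (tnth J ord0), (tnth J ord_max).
  by apply/eq_from_tnth => -[[|[|//]] i]; rewrite /tnth/=; apply: set_nth_default;
    rewrite size_tuple.
rewrite (nabla_covariant _ _ _ _ _ (gE c)).
rewrite (partial_rescaled_invmx (@open_cimg c) cx (smooth_contravariant_mx ac)
  (contravariant_mx_unit ac) (trmx_contravariant_mx ac cx)
  (tensor_smooth e ac _ _) (fun y cy => top_comp_neq0 ac cy)
  (partial_contravariant_mx a ac cx) (partial_top_comp a ac cx)).
set G' := _ - _ - _.
(* Parallelism of [g] is now reduced to recognising [G'] as the Christoffel matrix of [D'], which
   holds because the components of [Y] are those of [nu] with opposite sign. *)
suff -> : christoffel_mx D' c a x = G' by rewrite subrr mxE.
apply/matrixP => k j; rewrite !mxE D'E !YE !mxE big_ord1 !mxE eqxx andbT.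
by rewrite mulr_natl; ring.
Qed.

End MetricConnection.

Theorem theorem2p2 (R : realType) (n : nat) (M : manifold R n)
  (o : orientation M) (D : connection M) (D_special : special D)
  (sigma : tensor M 2 0) (sigma_metric : contravariant_riemannian_metric sigma)
  (mu : vector_field M)
  (sigma_eq : forall c, atlas M c -> forall x, cimg c x ->
     forall a b d : 'I_n,
       nabla D sigma c a [tuple b; d] [tuple] x =
         (a == b)%:R * mu c [tuple d] [tuple] x
         + (a == d)%:R * mu c [tuple b] [tuple] x) :
  exists D' : connection M,
    metric_connection D' /\ projectively_equivalent D D'.
Proof.
have [D_torsion_free [e [e_volume e_parallel]]] := D_special.
exact: projectively_metric D_torsion_free e_volume e_parallel sigma_metric sigma_eq.
Qed.
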